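(* Let $G$ be an embedded graph, let $k\in\mathbb{N}$, and let $b\in\mathbb{C}\setminus\{0\}$. Then $$k^{c(G)}R(G;k+1,k,1/k)=\sum_{\phi\in\mathcal{R}(G_m,k)}2^{\mathrm{tot}(\phi)};$$ $$P(G;k)=\sum_{\phi\in\mathcal{A}(G_m,k)}(-1)^{\mathrm{cr}(\phi)};$$ $$k^{c(G)}b^{r(G)}R\Big(G;\frac{k+b}{b},bk,\frac1k\Big)=\sum_{\phi\in\mathcal{R}(G_m,k)}(b+1)^{\mathrm{tot}(\phi)}b^{\mathrm{wh}(\phi)};$$ and, when $G$ is plane, $$k^{c(G)}b^{r(G)}\,T\Big(G;\frac{k}{b}+1,kb+1\Big)=\sum_{\phi\in\mathcal{R}(G_m,k)}(b+1)^{\mathrm{tot}(\phi)}b^{\mathrm{wh}(\phi)}.$$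
   Context: An embedded graph is a graph (loops and multiple edges allowed, not necessarily connected) cellularly embedded in a closed, possibly non-orientable, surface, i.e. each component of the complement (each face) is an open disc. Equivalently, it is a ribbon graph: a surface with boundary written as a union of vertex discs and edge discs (ribbons), each edge disc meeting the vertex discs in exactly two disjoint arcs. $c(G)$ is the number of connected components, $r(G)=|V(G)|-c(G)$, $n(G)=|E(G)|-r(G)$, and $f(G)$ is the number of boundary components of the ribbon graph (number of faces). For $A\subseteq E(G)$, $c(A),r(A),n(A),f(A)$ refer to the spanning ribbon subgraph $(V(G),A)$. $G$ is plane if it is connected and has Euler genus $0$ (i.e. $|V(G)|-|E(G)|+f(G)=2$). Ribbon graph (Bollobás–Riordan) polynomial: $R(G;x,y,z)=\sum_{A\subseteq E(G)}(x-1)^{r(G)-r(A)}y^{n(A)}z^{c(A)-f(A)+n(A)}$. Tutte polynomial: $T(G;x,y)=\sum_{A\subseteq E(G)}(x-1)^{r(G)-r(A)}(y-1)^{n(A)}$. Penrose polynomial: $P(G;\lambda)=\sum_{A\subseteq E(G)}(-1)^{|A|}\lambda^{f(G^{\tau(A)})}$, where the partial Petrial $G^{\tau(A)}$ is the ribbon graph obtained from $G$ by adding a half-twist to each edge in $A$. Medial graph: $G_m$ is the 4-regular graph embedded in the same surface obtained by placing a vertex $v_e$ on each edge $e$ of $G$ and drawing the edges of $G_m$ by following the face boundaries of $G$. An isolated vertex of $G$ contributes a free loop (a circular edge with no vertex), which counts as an edge of $G_m$. The canonical checkerboard colouring of $G_m$ colours black the faces of $G_m$ containing a vertex of $G$ and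 colours white the remaining faces (which correspond to the faces of $G$). $k$-valuations: a $k$-valuation of $G_m$ is a map $\phi:E(G_m)\to\{1,\dots,k\}$ (free loops are coloured too) such that for every colour $i$ and every vertex $v$ the number of $i$-coloured half-edges at $v$ is even. At a vertex $v$ let $h_1,h_2,h_3,h_4$ be the incident half-edges in cyclic order, labelled so that the corners between $h_1,h_2$ and between $h_3,h_4$ are white and those between $h_2,h_3$ and between $h_4,h_1$ are black. The type of $\phi$ at $v$ is total if all four half-edges have the same colour; otherwise two distinct colours occur, each twice, and the type is white if $h_1,h_2$ agree and $h_3,h_4$ agree; black if $h_2,h_3$ agree and $h_4,h_1$ agree; crossing if $h_1,h_3$ agree and $h_2,h_4$ agree. $\mathrm{tot}(\phi),\mathrm{wh}(\phi),\mathrm{cr}(\phi)$ are the numbers of vertices of total, white, crossing type. $\mathcal{A}(G_m,k)$ is the set of admissible $k$-valuations (every vertex is white or crossing), and $\mathcal{R}(G_m,k)$ is the set of $R$-permissible $k$-valuations (every vertex is white, black or total). $\mathbb{N}$ denotes the positive integers. *)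

(* Defs.v *)
From HB Require Import structures.
From mathcomp Require Import all_boot all_order all_fingroup all_algebra.
From mathcomp Require Import reals complex.

Set Implicit Arguments.
Unset Strict Implicit.
Unset Printing Implicit Defensive.

Import GRing.Theory.
Local Open Scope ring_scope.

(* A ribbon graph (equivalently, a cellularly embedded graph), given by a      *)
(* signed rotation system.  The half-edges of an edge [e] are [(e, false)] and *)
(* [(e, true)]; [rotation] is the cyclic order of the half-edges around the    *)
(* vertex discs, for an arbitrary orientation of each disc, and [twist e] says *)
(* whether the ribbon [e] is half-twisted with respect to these orientations.  *)
(* Loops, multiple edges, several components and vertices outside the image    *)
(* of [att] (isolated vertices) are allowed.                                   *)
Record ribbonGraph := RibbonGraph {
  vertex : finType;
  edge : finType;
  att : edge * bool -> vertex;
  rotation : {perm edge * bool};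
  twist : edge -> bool;
  att_rot : forall h h', (att h == att h') = (h' \in porbit rotation h)
}.

Section RibbonGraph.
Variable G : ribbonGraph.
Implicit Type A : {set edge G}.

Definition isolated (v : vertex G) : bool := v \notin codom (@att G).

(* A flag [(h, s)] is one of the four corners of the ribbon rectangle: the     *)
(* extremity of the arc where the half-edge [h] is glued to its vertex disc    *)
(* which comes last ([s = true]) or first ([s = false]) in the orientation of  *)
(* that disc.                                                                  *)
Definition flag : finType := ((edge G * bool) * bool)%type.

(* The other extremity of the same gluing arc. *)
Definition flag_end (x : flag) : flag := (x.1, ~~ x.2).

(* The other extremity of the same free side of the ribbon.  Along an          *)
(* untwisted ribbon the last extremity at one end faces the first extremity    *)
(* at the other end.                                                           *)
Definition flag_side (x : flag) : flag :=
  ((x.1.1, ~~ x.1.2), ~~ (x.2 (+) twist x.1.1)).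

(* The other extremity of the free arc of the vertex disc starting at [x]. *)
Definition flag_corner (x : flag) : flag :=
  if x.2 then (rotation G x.1, false) else ((rotation G)^-1%g x.1, true).

Lemma flag_cornerK : involutive flag_corner.
Proof. by move=> [h []]; rewrite /flag_corner /= ?permK ?permKV. Qed.

Lemma flag_endK : involutive flag_end.
Proof. by move=> [h s]; rewrite /flag_end /= negbK. Qed.

Lemma flag_sideK : involutive flag_side.
Proof.
by move=> [[e d] s]; rewrite /flag_side /=; case: d s (twist e) => [] [] [].
Qed.

Definition adj A : rel (vertex G) :=
  [rel u v | [exists e in A, exists d, (att (e, d) == u) && (att (e, ~~ d) == v)]].

Lemma adj_sym A : symmetric (adj A).
Proof.
suff H u v : adj A u v -> adj A v u by move=> u v; apply/idP/idP; apply: H.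
case/exists_inP=> e eA /existsP[d /andP[hu hv]].
by apply/exists_inP; exists e => //; apply/existsP; exists (~~ d); rewrite hv negbK.
Qed.

Definition ncomp A : nat := n_comp (adj A) [pred _ : vertex G | true].

Definition rank A : int := #|vertex G|%:Z - (ncomp A)%:Z.

Definition nullity A : int := #|A|%:Z - rank A.

(* Consecutive flags on the boundary of the spanning ribbon subgraph           *)
(* [(vertex G, A)]: at a ribbon of [A] the boundary follows the side of the    *)
(* ribbon, at a deleted ribbon it follows the former gluing arc.               *)
Definition boundary A : rel flag :=
  [rel x y | (y == flag_corner x)
          || (y == if x.1.1 \in A then flag_side x else flag_end x)].

Lemma boundary_sym A : symmetric (boundary A).
Proof.
suff H x y : boundary A x y -> boundary A y x.
  by move=> x y; apply/idP/idP; apply: H.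
case/orP=> /eqP->; first by rewrite /boundary /= flag_cornerK eqxx.
by case: ifP => xA; rewrite /boundary /= xA ?flag_sideK ?flag_endK eqxx orbT.
Qed.

(* The boundary of an isolated vertex of [G] carries no flag. *)
Definition nfaces A : nat :=
  (n_comp (boundary A) [pred _ : flag | true] + #|isolated|)%N.

Definition plane : Prop :=
  ncomp setT = 1%N
  /\ #|vertex G|%:Z - #|edge G|%:Z + (nfaces setT)%:Z = 2 :> int.

Definition petrial A : ribbonGraph :=
  @RibbonGraph (vertex G) (edge G) (@att G) (rotation G)
    (fun e => twist e (+) (e \in A)) (@att_rot G).

End RibbonGraph.

(* The exponents are integers so that no subtraction is truncated. *)
Definition ribbonPoly (F : fieldType) (G : ribbonGraph) (x y z : F) : F :=
  \sum_(A : {set edge G})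
    (x - 1) ^ (rank [set: edge G] - rank A) * y ^ nullity A
    * z ^ ((ncomp A)%:Z - (nfaces A)%:Z + nullity A).

Definition tuttePoly (F : fieldType) (G : ribbonGraph) (x y : F) : F :=
  \sum_(A : {set edge G})
    (x - 1) ^ (rank [set: edge G] - rank A) * (y - 1) ^ nullity A.

Definition penrosePoly (F : fieldType) (G : ribbonGraph) (l : F) : F :=
  \sum_(A : {set edge G})
    (-1) ^+ #|A| * l ^+ @nfaces (petrial A) setT.

(* A checkerboard coloured 4-regular embedded graph, as far as valuations are  *)
(* concerned.  [half v i] is the edge containing the half-edge [i] at [v], the *)
(* half-edges 0, 1, 2, 3 being in cyclic order around [v], with white corners  *)
(* between 0, 1 and between 2, 3, and black corners between 1, 2 and between   *)
(* 3, 0.  An edge with no half-edge is a free loop.                            *)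
Record checkerGraph := CheckerGraph {
  cvertex : finType;
  cedge : finType;
  half : cvertex -> 'I_4 -> cedge;
  half_card : forall a,
    #|[set p : cvertex * 'I_4 | half p.1 p.2 == a]| \in [:: 0; 2]%N
}.

Section Medial.
Variable G : ribbonGraph.

(* An edge of the medial graph follows a face boundary from one ribbon to the  *)
(* next, along a free arc of a vertex disc; an isolated vertex gives a free    *)
(* loop.                                                                       *)
Definition corner_arc (x : flag G) : {set flag G} := [set x; flag_corner x].

Definition corner_arcs : {set {set flag G}} := [set corner_arc x | x : flag G].

Definition medial_edge : finType :=
  ({a : {set flag G} | a \in corner_arcs}
   + {v : vertex G | isolated v})%type.

Definition medial_edge_of (x : flag G) : medial_edge :=
  inl (exist (fun a => a \in corner_arcs) (corner_arc x)
         (imset_f corner_arc (isT : x \in flag G))).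

(* The half-edges of the medial graph at the vertex placed on [e] are the four *)
(* flags of [e].  Two flags on the same side of the ribbon bound a corner in a *)
(* face of [G] (white), two flags at the same end of the ribbon bound a corner *)
(* in the face around a vertex of [G] (black).                                 *)
Definition medial_half (e : edge G) (i : 'I_4) : flag G :=
  let x : flag G := ((e, false), false) in
  tnth [tuple x; flag_side x; flag_end (flag_side x); flag_end x] i.

Lemma flag_corner_neq (x : flag G) : flag_corner x != x.
Proof.
case: x => h []; rewrite /flag_corner /=; apply/eqP => E;
  by have := congr1 snd E.
Qed.

Lemma medial_half_bij :
  bijective (fun p : edge G * 'I_4 => medial_half p.1 p.2).
Proof.
apply: inj_card_bij; last first.
  by rewrite !card_prod card_ord !card_bool -mulnA.
move=> [e i] [e' i'] /= E.
have fE f j : (medial_half f j).1.1 = f.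
  by case: j => [[|[|[|[|]]]] //= ?].
have Ee : e = e' by rewrite -(fE e i) E fE.
subst e'; congr pair; apply: val_inj; move: E.
by case: i => [[|[|[|[|]]]] //= ?]; case: i' => [[|[|[|[|]]]] //= ?] [];
  case: (twist e).
Qed.

Lemma medial_half_card (a : medial_edge) :
  #|[set p : edge G * 'I_4 | medial_edge_of (medial_half p.1 p.2) == a]|
    \in [:: 0; 2]%N.
Proof.
have -> : #|[set p : edge G * 'I_4 | medial_edge_of (medial_half p.1 p.2) == a]|
          = #|[set x : flag G | medial_edge_of x == a]|.
  rewrite -(on_card_preimset (f := fun p : edge G * 'I_4 => medial_half p.1 p.2)).
    by apply: eq_card => p; rewrite !inE.
  exact: onW_bij medial_half_bij.
case: a => [[a ha]|v]; last first.
  by rewrite (_ : [set x | _] = set0) ?cards0 //; apply/setP => x; rewrite !inE.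
case/imsetP: (ha) => y _ ay; rewrite (_ : [set x | _] = a).
  by rewrite ay cards2 eq_sym flag_corner_neq.
apply/setP => x; rewrite inE.
have -> : (medial_edge_of x == inl (exist _ a ha)) = (corner_arc x == a) by [].
rewrite ay /corner_arc; apply/eqP/idP => [<-|]; first by rewrite set21.
by case/set2P => -> //; rewrite flag_cornerK setUC.
Qed.

Definition medial : checkerGraph :=
  @CheckerGraph (edge G) medial_edge
    (fun e i => medial_edge_of (medial_half e i)) medial_half_card.

End Medial.

Section Valuations.
Variables (M : checkerGraph) (k : nat).
Implicit Types (phi : {ffun cedge M -> 'I_k}) (v : cvertex M).

Definition colour phi v (i : 'I_4) : 'I_k := phi (half v i).

Definition valuation phi : bool :=
  [forall c : 'I_k, forall v, ~~ odd #|[set i | colour phi v i == c]|].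

Definition total_at phi v : bool :=
  [forall i, forall j, colour phi v i == colour phi v j].

Definition white_at phi v : bool :=
  [&& ~~ total_at phi v, colour phi v 0 == colour phi v 1
    & colour phi v 2 == colour phi v 3].

Definition black_at phi v : bool :=
  [&& ~~ total_at phi v, colour phi v 1 == colour phi v 2
    & colour phi v 3 == colour phi v 0].

Definition crossing_at phi v : bool :=
  [&& ~~ total_at phi v, colour phi v 0 == colour phi v 2
    & colour phi v 1 == colour phi v 3].

Definition tot phi : nat := #|[set v | total_at phi v]|.
Definition wh phi : nat := #|[set v | white_at phi v]|.
Definition cr phi : nat := #|[set v | crossing_at phi v]|.

Definition admissible : {set {ffun cedge M -> 'I_k}} :=
  [set phi | valuation phi
           & [forall v, white_at phi v || crossing_at phi v]].

Definition Rpermissible : {set {ffun cedge M -> 'I_k}} :=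
  [set phi | valuation phi
           & [forall v, [|| white_at phi v, black_at phi v | total_at phi v]]].

End Valuations.

(* Main.v *)
Require Import Defs.
From HB Require Import structures.
From mathcomp Require Import all_boot all_order all_fingroup all_algebra.
From mathcomp Require Import reals complex zify ring.

(* Write [K = k].  By the rank formulas, the [A]-term of the third left-hand   *)
(* side is [b ^ |A| * K ^ f(A)], and [K ^ f(A)] counts the colourings of the   *)
(* medial edges which are constant along each boundary component of [A].  This *)
(* condition is local: at an edge of [A] the colours are paired across the     *)
(* white corners, at an edge outside [A] across the black corners.  Summing    *)
(* over [A] first gives, for each colouring, a product over the vertices with  *)
(* factors [b + 1] (total), [b] (white), [1] (black) and [0] (otherwise).  A   *)
(* half-twist replaces the white pairing by the crossing one, which gives the  *)
(* Penrose identity in the same way; the first identity is the case [b = 1].   *)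
(* For the Tutte polynomial, the exponent [c(A) - f(A) + n(A)] of [z] is the   *)
(* Euler genus of [A]: it vanishes for the empty set, grows with [A], and      *)
(* vanishes for [E(G)] when [G] is plane, so it vanishes for all [A].          *)

Set Implicit Arguments.
Unset Strict Implicit.
Unset Printing Implicit Defensive.

Import Order.TTheory GRing.Theory Num.Theory.
Local Open Scope ring_scope.
Local Open Scope complex_scope.

(** * Counting connected components *)

(** All four identities are double counts of pairs consisting of an edge set [A] and a colouring
    constant along the boundary components attached to [A], each weighted by [w ^ |A|], with [w = b]
    or [w = -1]. For fixed [A], [card_pairing_colourings] and [card_petrial_colourings] count the
    colourings; for a fixed colouring, [sum_subset_count] turns the sum over [A] into a product over
    edges, which [Rpermissible_weight] and [admissible_weight] evaluate. [ribbonPoly_term]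
    identifies the polynomial side. The Tutte case rests on [plane_euler_genus]. The topological
    core of its monotonicity argument is [connect_flag_end_setU1]: a ribbon glued to two different
    boundary components merges them. *)

Section AddRel.
Local Open Scope nat_scope.
Variables (T : finType) (e : rel T) (u v : T).
Hypothesis sym_e : symmetric e.

Definition addrel : rel T :=
  [rel x y | [|| e x y, (x == u) && (y == v) | (x == v) && (y == u)]].

Lemma addrel_sym : symmetric addrel.
Proof.
by move=> x y; rewrite /addrel /= sym_e [(x == u) && _]andbC [(x == v) && _]andbC
  [_ && _ || _]orbC.
Qed.

Let csym := sym_connect_sym sym_e.
Let csym' := sym_connect_sym addrel_sym.

Lemma connect_addrel_sub x y : connect e x y -> connect addrel x y.
Proof. by apply: connect_sub => {}x {}y exy; apply: connect1; rewrite /addrel /= exy. Qed.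

Lemma connect_addrel_id x y :
  ~~ connect e u x -> ~~ connect e v x ->
  connect addrel x y = connect e x y.
Proof.
move=> nux nvx; apply/idP/idP; last exact: connect_addrel_sub.
have cl : closed addrel (connect e x).
  apply: intro_closed; first exact: csym'.
  move=> a b /or3P[eab | /andP[/eqP-> _] | /andP[/eqP-> _]] /=.
  - by move=> xa; exact: connect_trans xa (connect1 eab).
  - by rewrite inE csym (negPf nux).
  - by rewrite inE csym (negPf nvx).
by move/(closed_connect cl); rewrite !inE connect0 => <-.
Qed.

End AddRel.

Section NComp.
Local Open Scope nat_scope.
Variables (T : finType) (e : rel T).
Hypothesis sym_e : symmetric e.
Let csym := sym_connect_sym sym_e.

(** Components avoiding [u] and [v] are untouched. The rest, the closure [a] of the pair, is the
    same set for both relations: it is one component once the pair is joined, and before that one or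
    two. *)
Lemma n_comp_addrel u v :
  n_comp e T = n_comp (addrel e u v) T + ~~ connect e u v.
Proof.
set e' := addrel e u v.
have csym' : connect_sym e' by apply/sym_connect_sym/addrel_sym.
pose a := closure e (pred2 u v).
have clE (r : rel T) x : (x \in closure r (pred2 u v)) = connect r x u || connect r x v.
  rewrite -topredE /=; apply/pred0Pn/orP => [[y /andP[xy]]|].
    by rewrite !inE => /orP[]/eqP yE; move: xy; rewrite yE; [left|right].
  by case=> xy; [exists u | exists v]; apply/andP; rewrite !inE eqxx ?orbT.
have uv : connect e' u v by apply: connect1; rewrite /e' /addrel /= !eqxx orbT.
have aE' : a =i closure e' (pred2 u v).
  move=> x; rewrite !clE; apply/idP/idP.
    by case/orP => /(@connect_addrel_sub _ _ u v) ->; rewrite ?orbT.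
  apply: contraTT; rewrite negb_or csym (csym x v) => /andP[nu nv].
  by rewrite !connect_addrel_id // csym (csym x v) negb_or nu.
rewrite !(n_compC a) {1}/a n_comp_closure2 // (eq_n_comp_r aE').
rewrite n_comp_closure2 // uv /= addSn add1n addSn [_ + ~~ _]addnC.
congr (_ + _).+1.
apply: eq_card => x; rewrite !inE; case: (boolP (x \in a)); rewrite ?andbF //.
rewrite clE negb_or csym (csym x v) => /andP[nu nv]; rewrite !andbT.
rewrite /roots /root; congr (odflt _ _ == _).
by apply: eq_pick => y; rewrite connect_addrel_id.
Qed.

Lemma n_comp_codom (T' : finType) (g : T -> T') :
  (forall x y, connect e x y = (g x == g y)) -> n_comp e T = #|codom g|.
Proof.
move=> eg; rewrite /n_comp_mem -(@card_in_image _ _ g); last first.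
  move=> x y /andP[/eqP rx _] /andP[/eqP ry _] /eqP.
  by rewrite -eg => /(fingraph.rootP csym); rewrite rx ry.
apply: eq_card => z; apply/imageP/codomP => [[x _ ->] | [x ->]]; first by exists x.
exists (fingraph.root e x); first by rewrite inE /= roots_root.
by apply/eqP; rewrite -eg connect_root.
Qed.

End NComp.

Lemma involution_card_even (T : finType) (f : T -> T) (S : {set T}) :
  {in S, involutive f} -> {in S, forall x, f x \in S} ->
  {in S, forall x, f x != x} -> ~~ odd #|S|.
Proof.
have [n] := ubnP #|S|; elim: n S => // n IH S; rewrite ltnS => leS fK fS fN.
have [->|[x xS]] := set_0Vmem S; first by rewrite cards0.
have fxS : f x \in S :\ x by rewrite !inE fN //= fS.
rewrite (cardsD1 x) xS (cardsD1 (f x)) fxS /= negbK.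
have sub y : y \in S :\ x :\ f x -> y \in S by rewrite !inE => /and3P[].
apply: IH => [|y /sub/fK|y|y /sub/fN] //.
  move: leS; rewrite (cardsD1 x) xS (cardsD1 (f x)) fxS; apply: leq_trans.
  by rewrite ltnS leqnSn.
rewrite !inE => /and3P[y1 y2 yS]; rewrite fS // andbT; apply/andP; split.
  by apply: contra y2 => /eqP E; rewrite -(fK y yS) E fK.
by apply: contra y1 => /eqP E; rewrite -E fK.
Qed.

(** * Monotonicity of the Euler genus *)

Section Genus.
Local Open Scope nat_scope.
Variable G : ribbonGraph.
Implicit Types (A : {set edge G}) (e : edge G) (x y : flag G).

(** This is [2 c(A) - (v(G) - |A| + f(A))], the Euler genus of the surface obtained by capping the
    boundary of the spanning ribbon subgraph. *)
Definition euler_genus A : int :=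
  ((ncomp A)%:Z - (nfaces A)%:Z + nullity A)%R.

Lemma flag_side_end x : flag_side (flag_end x) = flag_end (flag_side x).
Proof. by case: x => [[e d] s]; rewrite /flag_side /flag_end /= addNb. Qed.

Lemma flag_end_neq x : flag_end x != x.
Proof. by case: x => h []; apply/eqP => E; have := congr1 snd E. Qed.

Lemma flag_side_neq x : flag_side x != x.
Proof.
by case: x => -[e d] s; apply/eqP => E; have := congr1 (fun y => y.1.2) E; case: d E.
Qed.

Lemma flags_of_edge e x y : x.1.1 = e -> y.1.1 = e ->
  y \in [:: x; flag_side x; flag_end x; flag_side (flag_end x)].
Proof.
case: x y => -[_ d] s [[_ d'] s'] /= -> ->.
by case: d d' s s' => [] [] [] []; rewrite !inE /flag_side /flag_end /=;
  case: (twist e); rewrite !xpair_eqE !eqxx.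
Qed.

Lemma att_flag_corner x : att (flag_corner x).1 = att x.1.
Proof.
case: x => h []; apply/eqP; rewrite att_rot /= porbit_sym.
  exact: (mem_porbit _ 1).
by rewrite -porbitV; apply: (mem_porbit _ 1).
Qed.

(** Corner and end moves stay at one vertex disc, and side moves run along a ribbon of [A], so a
    boundary component lies in one connected component. *)
Lemma connect_att A x y :
  connect (boundary A) x y -> connect (adj A) (att x.1) (att y.1).
Proof.
have cs := sym_connect_sym (boundary_sym A).
have csA := sym_connect_sym (adj_sym A).
pose S := [pred z : flag G | connect (adj A) (att x.1) (att z.1)].
have cl : closed (boundary A) S.
  apply: intro_closed => // a b ab; rewrite !inE => xa.
  case/orP: ab => /eqP->; first by rewrite att_flag_corner.
  case: ifP => // aA; apply: connect_trans xa (connect1 _).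
  apply/exists_inP; exists a.1.1 => //; apply/existsP; exists a.1.2.
  by case: a {aA} => [[f d] s]; rewrite /flag_side /= !eqxx.
by move/(closed_connect cl); rewrite !inE connect0.
Qed.

Lemma adj_setU1 e A :
  adj (e |: A) =2 addrel (adj A) (att (e, false)) (att (e, true)).
Proof.
move=> u v; rewrite /addrel /=; apply/exists_inP/or3P.
  case=> f; rewrite !inE => /orP[/eqP-> | fA] /existsP[d /andP[/eqP<- /eqP<-]].
    by case: d => /=; rewrite !eqxx; [apply: Or33 | apply: Or32].
  by apply: Or31; apply/exists_inP; exists f => //; apply/existsP;
     exists d; rewrite !eqxx.
case=> [/exists_inP[f fA H] | /andP[/eqP-> /eqP->] | /andP[/eqP-> /eqP->]].
- by exists f => //; rewrite !inE fA orbT.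
- by exists e; rewrite ?setU11 //; apply/existsP; exists false; rewrite !eqxx.
- by exists e; rewrite ?setU11 //; apply/existsP; exists true; rewrite !eqxx.
Qed.

Lemma ncomp_setU1 e A :
  ncomp A = ncomp (e |: A) + ~~ connect (adj A) (att (e, false)) (att (e, true)).
Proof.
rewrite /ncomp; have := n_comp_addrel (adj_sym A) (att (e, false)) (att (e, true)).
by rewrite -(eq_n_comp (eq_connect (adj_setU1 e A))).
Qed.

Section AddEdge.
Variables (A : {set edge G}) (e : edge G).
Hypothesis eNA : e \notin A.
Let B := e |: A.
Variable x : flag G.
Hypothesis xe : x.1.1 = e.

Let flag_inv y := if y.1.1 \in A then flag_side y else flag_end y.

Let flag_inv_edge y : (flag_inv y).1.1 = y.1.1.
Proof. by rewrite /flag_inv; case: ifP. Qed.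

Let flag_invK : involutive flag_inv.
Proof.
move=> y; rewrite [LHS]/flag_inv flag_inv_edge /flag_inv.
by case: (_ \in A); rewrite ?flag_sideK ?flag_endK.
Qed.

Let flag_inv_neq y : flag_inv y != y.
Proof. by rewrite /flag_inv; case: ifP; rewrite ?flag_side_neq ?flag_end_neq. Qed.

(* On both sides all four flags of [e] are joined, so that adding [e] to [A]   *)
(* changes the number of boundary components by the difference of two          *)
(* corrections from [n_comp_addrel].                                           *)
Lemma connect_boundary_pairs :
  connect (addrel (boundary A) x (flag_side x))
    =2 connect (addrel (boundary B) x (flag_end x)).
Proof.
pose rA := addrel (boundary A) x (flag_side x).
pose rB := addrel (boundary B) x (flag_end x).
have crA : connect_sym rA by apply/sym_connect_sym/addrel_sym/boundary_sym.
have crB : connect_sym rB by apply/sym_connect_sym/addrel_sym/boundary_sym.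
have bA y : y.1.1 = e -> connect rA y (flag_end y).
  move=> ye; apply: connect1.
  by rewrite /rA /addrel /boundary /= ye (negPf eNA) eqxx orbT.
have bB y : y.1.1 = e -> connect rB y (flag_side y).
  by move=> ye; apply: connect1; rewrite /rB /addrel /boundary /= ye setU11 eqxx orbT.
have pA : connect rA x (flag_side x).
  by apply: connect1; rewrite /rA /addrel /= !eqxx orbT.
have pB : connect rB x (flag_end x).
  by apply: connect1; rewrite /rB /addrel /= !eqxx orbT.
have allA y : y.1.1 = e -> connect rA x y.
  move=> ye; have := flags_of_edge xe ye; rewrite !inE => /or4P[]/eqP->.
  - exact: connect0.
  - exact: pA.
  - exact: bA.
  - by rewrite flag_side_end; apply: connect_trans pA _; apply: bA.
have allB y : y.1.1 = e -> connect rB x y.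
  move=> ye; have := flags_of_edge xe ye; rewrite !inE => /or4P[]/eqP->.
  - exact: connect0.
  - exact: bB.
  - exact: pB.
  - by apply: connect_trans pB _; apply: bB.
have inB y : y.1.1 != e -> (y.1.1 \in B) = (y.1.1 \in A) by rewrite !inE => /negPf->.
move=> a b; apply/idP/idP; apply: connect_sub => {}a {}b.
  have [ae|ae] := eqVneq a.1.1 e.
    case/or3P => [/orP[/eqP->|/eqP->] | /andP[/eqP-> /eqP->] | /andP[/eqP-> /eqP->]].
    - by apply: connect1; rewrite /addrel /boundary /= eqxx.
    - rewrite ae (negPf eNA); apply: connect_trans (allB (flag_end a) ae).
      by rewrite -/rB crB; apply: allB.
    - exact: bB.
    - by rewrite -/rB crB; apply: bB.
  case/or3P => [H | /andP[/eqP E] | /andP[/eqP E]].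
  - move: H; rewrite /boundary /= -inB // => H; apply: connect1.
    by rewrite /addrel /boundary /= H.
  - by rewrite E xe eqxx in ae.
  - by rewrite E /= xe eqxx in ae.
have [ae|ae] := eqVneq a.1.1 e.
  case/or3P => [/orP[/eqP->|/eqP->] | /andP[/eqP-> /eqP->] | /andP[/eqP-> /eqP->]].
  - by apply: connect1; rewrite /addrel /boundary /= eqxx.
  - rewrite ae setU11; apply: connect_trans (allA (flag_side a) ae).
    by rewrite -/rA crA; apply: allA.
  - exact: bA.
  - by rewrite -/rA crA; apply: bA.
case/or3P => [H | /andP[/eqP E] | /andP[/eqP E]].
- move: H; rewrite /boundary /= inB // => H; apply: connect1.
  by rewrite /addrel /boundary /= H.
- by rewrite E xe eqxx in ae.
- by rewrite E /= xe eqxx in ae.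
Qed.

(* Otherwise the boundary arc from [x] avoiding the ribbon [e] would meet no   *)
(* other flag of [e]; but its flags are paired by [flag_corner], and all of    *)
(* them except [x] are paired by [flag_inv], so their number would be both     *)
(* even and odd.                                                               *)
Lemma connect_flag_end_setU1 :
  ~~ connect (boundary A) x (flag_side x) -> connect (boundary B) x (flag_end x).
Proof.
move=> nA; apply/negPn/negP => nB.
(* [w] follows the boundary but stops at flags of [e]; it is contained in the boundary relations of
   both [A] and [B], which differ only there. *)
pose w : rel (flag G) := [rel y z | (z == flag_corner y)
                          || (y.1.1 != e) && (z == flag_inv y)].
pose S := [set y | connect w x y].
have wA : subrel (connect w) (connect (boundary A)).
  apply: connect_sub => y z /orP[/eqP->|/andP[_ /eqP->]]; apply: connect1;
  by rewrite /boundary /= eqxx ?orbT.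
have wB : subrel (connect w) (connect (boundary B)).
  apply: connect_sub => y z /orP[/eqP->|/andP[/negPf ye /eqP->]]; apply: connect1;
  by rewrite /boundary /= /flag_inv ?inE ?ye eqxx ?orbT.
have xS : x \in S by rewrite inE connect0.
(* Of the other flags of [e], [flag_end x] is excluded by [nB], [flag_side x] by [nA], and the
   opposite one too by [nA], since it is joined to [flag_side x] in [A]. *)
have Se y : y \in S :\ x -> y.1.1 != e.
  rewrite !inE => /andP[yx xy]; apply/eqP => ye.
  have := flags_of_edge xe ye; rewrite !inE (negPf yx) /= => /or3P[]/eqP E;
    rewrite {}E in xy.
  - by rewrite wA in nA.
  - by rewrite wB in nB.
  - case/negP: nA; apply: connect_trans (wA _ _ xy) (connect1 _).
    by rewrite /boundary /= xe (negPf eNA) flag_side_end flag_endK eqxx orbT.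
have S0 : ~~ odd #|S|.
  apply: (@involution_card_even _ (@flag_corner G)) => [y _|y|y _].
  - exact: flag_cornerK.
  - by rewrite !inE => xy; apply: connect_trans xy (connect1 _); rewrite /w /= eqxx.
  - exact: flag_corner_neq.
have : ~~ odd #|S :\ x|.
  apply: (@involution_card_even _ flag_inv) => [y _|y yS|y _] //.
  have ye := Se _ yS; move: yS; rewrite !inE => /andP[_ xy]; apply/andP; split.
    by apply: contra ye => /eqP E; rewrite -flag_inv_edge E xe.
  by apply: connect_trans xy (connect1 _); rewrite /w /= ye eqxx orbT.
by move: S0; rewrite (cardsD1 x) xS /= => /negPn->.
Qed.

End AddEdge.

(** The genus changes by [1 - 2p + q - r], where [p], [q], [r] say that a pair is disconnected: the
    ends of [e] in [A], the flags [x], [flag_side x] on the boundary of [A], and [x], [flag_end x]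
    on that of [e |: A]. By [connect_att], [p] implies [q]; by [connect_flag_end_setU1], [q]
    excludes [r]; so the change is nonnegative. *)
Lemma euler_genus_setU1 A e : e \notin A -> (euler_genus A <= euler_genus (e |: A))%R.
Proof.
move=> eA; pose x : flag G := ((e, false), false); have xe : x.1.1 = e by [].
have c := ncomp_setU1 e A.
have fA := n_comp_addrel (boundary_sym A) x (flag_side x).
have fB := n_comp_addrel (boundary_sym (e |: A)) x (flag_end x).
rewrite (eq_n_comp (connect_boundary_pairs eA xe)) in fA.
have h1 := @connect_att A x (flag_side x).
have h2 := connect_flag_end_setU1 eA xe.
rewrite /euler_genus /nfaces /nullity /rank cardsU1 eA.
have arith (cA cB v a nA nB i n : nat) (p q r : bool) :
  cA = cB + p -> nA = n + q -> nB = n + r -> (p -> q) -> (q -> ~~ r) ->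
  (cA%:Z - (nA + i)%N%:Z + (a%:Z - (v%:Z - cA%:Z))
   <= cB%:Z - (nB + i)%N%:Z + ((1 + a)%N%:Z - (v%:Z - cB%:Z)))%R.
  by move=> -> -> ->; case: p q r => [] [] [] // H1 H2;
     try (by have := H1 isT); try (by have := H2 isT); lia.
apply: arith c fA fB _ _; first exact/contra/h1.
by move=> /h2->.
Qed.

Lemma euler_genus_sub A A' : A \subset A' -> (euler_genus A <= euler_genus A')%R.
Proof.
have [n] := ubnP #|A' :\: A|; elim: n A => // n IH A; rewrite ltnS => len sub.
have [E|[e]] := set_0Vmem (A' :\: A).
  suff -> : A = A' by [].
  by apply/eqP; rewrite eqEsubset sub -setD_eq0 E eqxx.
rewrite inE => /andP[eA eA']; apply: le_trans (euler_genus_setU1 eA) _.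
apply: IH; last by rewrite subUset sub1set eA'.
apply: leq_trans len; rewrite [ltnRHS](cardsD1 e) !inE eA eA' add1n ltnS.
by apply/subset_leq_card/subsetP => f; rewrite !inE negb_or -andbA.
Qed.

Lemma euler_genus0 : euler_genus set0 = 0%R.
Proof.
have csE := sym_connect_sym (boundary_sym (set0 : {set edge G})).
have -> : euler_genus set0 = ((ncomp (set0 : {set edge G}))%:Z *+ 2
   - (nfaces (set0 : {set edge G}))%:Z - #|vertex G|%:Z)%R.
  by rewrite /euler_genus /nullity /rank cards0; lia.
have -> : ncomp (set0 : {set edge G}) = #|vertex G|.
  rewrite /ncomp (n_comp_codom (adj_sym _) (g := id)) => [|u v].
    by apply: eq_card => u; rewrite codom_f.
  apply/idP/eqP => [|->]; last exact: connect0.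
  have cl : closed (adj (set0 : {set edge G})) (pred1 u).
    by move=> a b /exists_inP[f]; rewrite inE.
  by move/(closed_connect cl); rewrite !inE eqxx => /esym/eqP.
suff -> : nfaces (set0 : {set edge G}) = #|vertex G| by lia.
(* Without edges, each non-isolated vertex disc has one boundary circle carrying flags, so [att]
   classifies the components; isolated vertices supply the remaining faces. *)
rewrite /nfaces (n_comp_codom (boundary_sym _) (g := fun x : flag G => att x.1)).
  rewrite -(cardC [in codom (fun x : flag G => att x.1)]); congr (_ + _).
  apply: eq_card => v; rewrite !inE; apply: (congr1 negb).
  by apply/codomP/codomP => [[h ->]|[x ->]]; [exists (h, false) | exists x.1].
move=> x y; apply/idP/idP => [/connect_att | ].
  have cl : closed (adj (set0 : {set edge G})) (pred1 (att x.1)).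
    by move=> a b /exists_inP[f]; rewrite inE.
  by move/(closed_connect cl); rewrite !inE eqxx eq_sym.
have e1 z : connect (boundary set0) z (flag_end z).
  by apply: connect1; rewrite /boundary /= inE eqxx orbT.
have e2 (z : flag G) s : connect (boundary set0) z (z.1, s).
  have [<-|n] := eqVneq z.2 s; first by rewrite -surjective_pairing connect0.
  rewrite (_ : (z.1, s) = flag_end z) // /flag_end; congr pair.
  by case: s z.2 n => [] [].
rewrite att_rot => /porbitP[n E].
apply: (connect_trans (e2 x true)); rewrite csE; apply: (connect_trans (e2 y true)).
rewrite /= E csE.
(* A corner move followed by an end move advances one step of the rotation, hence the whole circle
   is reached. *)
have e3 h : connect (boundary set0) (h, true) (rotation G h, true).
  apply: (@connect_trans _ _ (rotation G h, false)); last exact: e2.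
  by apply: connect1; rewrite /boundary /= /flag_corner /= eqxx.
elim: n {E} => [|n IH]; first by rewrite expg0 perm1 connect0.
by apply: connect_trans IH _; rewrite expgSr permM; apply: e3.
Qed.

(** By monotonicity the genus lies between its values at the empty set and at [E(G)], both zero. *)
Lemma plane_euler_genus A : plane G -> euler_genus A = 0%R.
Proof.
case=> c1 E; apply/eqP; rewrite eq_le -{2}euler_genus0 euler_genus_sub ?sub0set // andbT.
rewrite (_ : 0%R = euler_genus [set: edge G]) ?euler_genus_sub ?subsetT //.
by rewrite /euler_genus /nullity /rank cardsT c1; lia.
Qed.

End Genus.

(** * Vertex types and local weights *)

Lemma ord4_ind (P : 'I_4 -> Prop) : P 0 -> P 1 -> P 2 -> P 3 -> forall i, P i.
Proof.
move=> P0 P1 P2 P3 [[|[|[|[|i]]]] // lt_i4].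
- by rewrite (_ : Ordinal _ = 0) //; apply: val_inj.
- by rewrite (_ : Ordinal _ = 1) //; apply: val_inj.
- by rewrite (_ : Ordinal _ = 2) //; apply: val_inj.
- by rewrite (_ : Ordinal _ = 3) //; apply: val_inj.
Qed.

Lemma eq_pairs (T : eqType) (a b c d : T) :
  [&& a == b, b == a, c == d & d == c] = (a == b) && (d == c).
Proof. by rewrite (eq_sym b a) (eq_sym c d); case: (a == b); case: (d == c). Qed.

Section SubsetSums.
Variable F : fieldType.

Lemma prod_if_const (I : finType) (P : pred I) (a : F) :
  \prod_i (if P i then a else 1) = a ^+ #|[set i | P i]|.
Proof. by rewrite -big_mkcond prodr_const cardsE. Qed.

Lemma prod_natr_bool (I : finType) (P : pred I) :
  \prod_i (P i)%:R = [forall i, P i]%:R :> F.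
Proof.
case: (boolP [forall i, P i]) => [/forallP H|].
  by rewrite big1 // => i _; rewrite H.
by case/forallPn => i /negPf H; rewrite (bigD1 i) //= H mul0r.
Qed.

(** Expanding the product chooses at each [e] one of two terms; [A] is the set where the term with
    [w] is chosen. *)
Lemma sum_subset_count (E S : finType) (P Q : S -> pred E) (w : F) :
  \sum_(A : {set E})
     w ^+ #|A| * #|[set s | [forall e, if e \in A then P s e else Q s e]]|%:R
  = \sum_s \prod_e (w * (P s e)%:R + (Q s e)%:R).
Proof.
under [RHS]eq_bigr do rewrite bigA_distr.
rewrite exchange_big /=; apply: eq_bigr => A _.
rewrite -[X in _ * X%:R]sum1_card natr_sum big_distrr /= big_mkcond.
apply: eq_bigr => s _.
have -> : \prod_e (if e \in A then w * (P s e)%:R else (Q s e)%:R)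
  = \prod_e ((if e \in A then w else 1) * (if e \in A then P s e else Q s e)%:R).
  by apply: eq_bigr => e _; case: ifP; rewrite ?mul1r.
rewrite big_split /= prod_if_const prod_natr_bool inE cardsE.
by case: [forall e, _]; rewrite ?mulr0 ?mulr1.
Qed.

End SubsetSums.

Section VertexTypes.
Variables (M : checkerGraph) (k : nat).
Implicit Types (phi : {ffun cedge M -> 'I_k}) (v : cvertex M).

(** Unlike the types, pairings allow four equal colours: a total vertex satisfies all three. *)
Definition white_pairing phi v : bool :=
  (colour phi v 0 == colour phi v 1) && (colour phi v 2 == colour phi v 3).
Definition black_pairing phi v : bool :=
  (colour phi v 1 == colour phi v 2) && (colour phi v 3 == colour phi v 0).
Definition crossing_pairing phi v : bool :=
  (colour phi v 0 == colour phi v 2) && (colour phi v 1 == colour phi v 3).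

Lemma total_atE phi v : total_at phi v =
  [&& colour phi v 0 == colour phi v 1, colour phi v 1 == colour phi v 2
    & colour phi v 2 == colour phi v 3].
Proof.
apply/forallP/and3P => [H | [/eqP H0 /eqP H1 /eqP H2] i].
  by split; apply: (forallP (H _)).
have all i' : colour phi v i' = colour phi v 3.
  by move: i'; apply: ord4_ind; rewrite ?H0 ?H1 ?H2.
by apply/forallP => j; rewrite !all.
Qed.

Lemma total_at_white_black phi v :
  total_at phi v = white_pairing phi v && black_pairing phi v.
Proof.
rewrite total_atE /white_pairing /black_pairing.
have [->|_] //= := eqVneq (colour phi v 0) (colour phi v 1).
have [->|_] //= := eqVneq (colour phi v 2) (colour phi v 3); rewrite ?andbF //.
by rewrite andbT [X in _ && X]eq_sym andbb.
Qed.

Lemma total_at_white_crossing phi v :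
  total_at phi v = white_pairing phi v && crossing_pairing phi v.
Proof.
rewrite total_atE /white_pairing /crossing_pairing.
have [->|_] //= := eqVneq (colour phi v 0) (colour phi v 1).
have [->|_] //= := eqVneq (colour phi v 2) (colour phi v 3); rewrite ?andbF //.
by rewrite andbT andbb.
Qed.

(** Two pairs of equal colours make every colour count even, so the parity condition follows from
    the local conditions. *)
Lemma valuation_pairing phi :
  (forall v, [|| white_pairing phi v, black_pairing phi v | crossing_pairing phi v]) ->
  valuation phi.
Proof.
move=> H; apply/forallP => c; apply/forallP => v; rewrite cardsE -sum1_card big_mkcond /=.
have bigE (f : 'I_4 -> nat) : (\sum_i f i = f 0%R + (f 1%R + (f 2%R + f 3%R)))%N.
  rewrite !big_ord_recl big_ord0 addn0.
  by congr (f _ + (f _ + (f _ + f _)))%N; apply: val_inj.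
rewrite bigE !unfold_in; move: (H v) => /or3P[] /andP[/eqP-> /eqP->];
  do 2!case: (eqn _ c) => //.
Qed.

Section Weights.
Variable F : fieldType.

Lemma Rpermissible_weight (b : F) phi :
  \prod_v (b * (white_pairing phi v)%:R + (black_pairing phi v)%:R)
  = (b + 1) ^+ tot phi * b ^+ wh phi * (phi \in Rpermissible M k)%:R.
Proof.
have -> : (phi \in Rpermissible M k)
          = [forall v, white_pairing phi v || black_pairing phi v].
  rewrite inE; apply/andP/forallP => [[_ /forallP H] v | H].
    case/or3P: (H v) => [/and3P[_ a c] | /and3P[_ a c] |].
    - by rewrite /white_pairing a c.
    - by rewrite orbC /black_pairing a c.
    - by rewrite total_at_white_black => /andP[->].
  split; first by apply: valuation_pairing => v; rewrite orbA H.
  apply/forallP => v; rewrite /white_at /black_at total_at_white_black.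
  rewrite -/(white_pairing phi v) -/(black_pairing phi v).
  by move: (H v); case: white_pairing; case: black_pairing.
rewrite /tot /wh -!prod_if_const -prod_natr_bool -!big_split; apply: eq_bigr => v _.
rewrite /white_at total_at_white_black -/(white_pairing phi v).
by case: white_pairing; case: black_pairing;
  rewrite /= ?mulr0 ?mulr1 ?add0r ?addr0 ?mul1r.
Qed.

(** At a total vertex both pairings hold and [-1 + 1] cancels; only purely white or purely crossing
    vertices survive. *)
Lemma admissible_weight phi :
  \prod_v (-1 * (crossing_pairing phi v)%:R + (white_pairing phi v)%:R)
  = (-1) ^+ cr phi * (phi \in admissible M k)%:R :> F.
Proof.
have -> : (phi \in admissible M k)
          = [forall v, white_pairing phi v (+) crossing_pairing phi v].
  rewrite inE; apply/andP/forallP => [[_ /forallP H] v | H].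
    move: (H v); rewrite /white_at /crossing_at total_at_white_crossing.
    rewrite -/(white_pairing phi v) -/(crossing_pairing phi v).
    by case: white_pairing; case: crossing_pairing.
  split.
    apply: valuation_pairing => v; move: (H v).
    by case: white_pairing => //= ->; rewrite orbT.
  apply/forallP => v; rewrite /white_at /crossing_at total_at_white_crossing.
  rewrite -/(white_pairing phi v) -/(crossing_pairing phi v).
  by move: (H v); case: white_pairing; case: crossing_pairing.
rewrite /cr -!prod_if_const -prod_natr_bool -!big_split; apply: eq_bigr => v _.
rewrite /crossing_at total_at_white_crossing -/(crossing_pairing phi v).
by case: white_pairing; case: crossing_pairing;
  rewrite /= ?mulr0 ?mulr1 ?add0r ?addr0 ?mul1r ?addNr.
Qed.

End Weights.
End VertexTypes.

(** * Colourings constant along boundary components *)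

Lemma forall_flag_edge (G : ribbonGraph) (P : pred (flag G)) :
  [forall x, P x] = [forall e, let x : flag G := ((e, false), false) in
     [&& P x, P (flag_side x), P (flag_end x) & P (flag_side (flag_end x))]].
Proof.
apply/forallP/forallP => [H e | H y]; first by rewrite /= !H.
have /and4P[H1 H2 H3 H4] := H y.1.1.
have := @flags_of_edge G y.1.1 ((y.1.1, false), false) y erefl erefl.
by rewrite !inE => /or4P[]/eqP->.
Qed.

Section Colourings.
Variables (G : ribbonGraph) (k : nat).
Implicit Types (phi : {ffun medial_edge G -> 'I_k}) (A : {set edge G}).

Definition boundary_inv A (x : flag G) : flag G :=
  if x.1.1 \in A then flag_side x else flag_end x.

Lemma medial_edge_of_eq (x y : flag G) :
  medial_edge_of x = medial_edge_of y -> y = x \/ y = flag_corner x.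
Proof.
case=> E; have : y \in corner_arc x by rewrite E set21.
by case/set2P; [left | right].
Qed.

Lemma medial_edge_of_corner (x : flag G) :
  medial_edge_of (flag_corner x) = medial_edge_of x.
Proof.
by congr inl; apply: val_inj; rewrite /= /corner_arc flag_cornerK setUC.
Qed.

(** Corner moves do not leave a medial edge, so these colourings are exactly the free choices of a
    colour per boundary component, the free loops of isolated vertices included. *)
Lemma card_boundary_colourings A :
  #|[set phi : {ffun medial_edge G -> 'I_k} | [forall x, phi (medial_edge_of x)
                          == phi (medial_edge_of (boundary_inv A x))]]|
  = (k ^ nfaces A)%N.
Proof.
set D := [set _ | _]; pose e := boundary A.
have cs : connect_sym e := sym_connect_sym (boundary_sym A).
pose I : finType :=
  ({x : flag G | fingraph.roots e x} + {v : vertex G | isolated v})%type.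
pose h (i : I) : medial_edge G :=
  match i with inl r => medial_edge_of (val r) | inr v => inr v end.
pose restr phi : {ffun I -> 'I_k} := [ffun i => phi (h i)].
pose rt x : {x : flag G | fingraph.roots e x} :=
  exist _ (fingraph.root e x) (roots_root cs x).
have DP phi x y : phi \in D -> connect e x y ->
    phi (medial_edge_of x) = phi (medial_edge_of y).
  rewrite inE => /forallP H.
  have cl : closed e [pred z | phi (medial_edge_of x) == phi (medial_edge_of z)].
    apply: intro_closed => // a b /orP[]/eqP->; rewrite !inE => /eqP->.
      by rewrite medial_edge_of_corner.
    exact: H.
  by move/(closed_connect cl); rewrite !inE eqxx => /esym/eqP.
have exr (a : {a : {set flag G} | a \in corner_arcs G}) :
    exists x, inl a == medial_edge_of x :> medial_edge G.
  case: a => a aP; case/imsetP: (aP) => x _ ax; exists x; apply/eqP; congr inl.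
  exact: val_inj.
rewrite -(card_in_imset (f := restr)); last first.
  move=> phi psi hphi hpsi /ffunP E; apply/ffunP => -[a|v].
    have [x /eqP->] := exr a; rewrite (DP _ _ _ hphi (connect_root e x)).
    rewrite (DP _ _ _ hpsi (connect_root e x)).
    by have := E (inl (rt x)); rewrite !ffunE.
  by have := E (inr v); rewrite !ffunE.
have -> : restr @: D = setT.
  apply/setP => psi; rewrite in_setT; apply/imsetP.
  (* Surjectivity: an arc receives the colour of the component of a chosen flag. Its two flags
     differ by a corner move, so the choice is immaterial. *)
  pose f (a : medial_edge G) : 'I_k :=
    match a with inl a => psi (inl (rt (xchoose (exr a)))) | inr v => psi (inr v) end.
  have fE x : f (medial_edge_of x) = psi (inl (rt x)).
    rewrite /f /medial_edge_of; set a := exist _ _ _.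
    have /eqP/medial_edge_of_eq xx := xchooseP (exr a).
    congr (psi (inl _)); apply: val_inj => /=; apply/eqP.
    rewrite (root_connect cs) cs; case: xx => ->; first exact: connect0.
    by apply: connect1; rewrite /e /boundary /= eqxx.
  exists (finfun f).
    rewrite inE; apply/forallP => x; rewrite !ffunE !fE.
    apply/eqP; congr (psi (inl _)); apply: val_inj => /=; apply/eqP.
    by rewrite (root_connect cs); apply: connect1; rewrite /e /boundary /= eqxx orbT.
  apply/ffunP => -[r|v]; rewrite !ffunE // [h _]/= fE; congr (psi (inl _)).
  apply: val_inj => /=; exact/esym/eqP/(valP r).
rewrite cardsT card_ffun card_ord card_sum !card_sig; congr (_ ^ (_ + _))%N.
by apply: eq_card => x; rewrite !inE andbT.
Qed.

Lemma white_pairingE (phi : {ffun cedge (medial G) -> 'I_k}) (e : edge G) :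
  let x : flag G := ((e, false), false) in
  white_pairing phi e =
    (phi (medial_edge_of x) == phi (medial_edge_of (flag_side x)))
    && (phi (medial_edge_of (flag_side (flag_end x)))
        == phi (medial_edge_of (flag_end x))).
Proof. by move=> x; rewrite flag_side_end. Qed.

Lemma black_pairingE (phi : {ffun cedge (medial G) -> 'I_k}) (e : edge G) :
  let x : flag G := ((e, false), false) in
  black_pairing phi e =
    (phi (medial_edge_of (flag_side x)) == phi (medial_edge_of (flag_side (flag_end x))))
    && (phi (medial_edge_of (flag_end x)) == phi (medial_edge_of x)).
Proof. by move=> x; rewrite flag_side_end. Qed.

Lemma crossing_pairingE (phi : {ffun cedge (medial G) -> 'I_k}) (e : edge G) :
  let x : flag G := ((e, false), false) in
  crossing_pairing phi e =
    (phi (medial_edge_of x) == phi (medial_edge_of (flag_side (flag_end x))))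
    && (phi (medial_edge_of (flag_side x)) == phi (medial_edge_of (flag_end x))).
Proof. by move=> x; rewrite flag_side_end. Qed.

Lemma card_pairing_colourings A :
  #|[set phi : {ffun cedge (medial G) -> 'I_k} |
      [forall e, if e \in A then white_pairing phi e else black_pairing phi e]]|
  = (k ^ nfaces A)%N.
Proof.
rewrite -card_boundary_colourings; apply: eq_card => phi; rewrite !inE forall_flag_edge.
apply: eq_forallb => e; cbv zeta; set x : flag G := ((e, false), false).
case: (boolP (e \in A)) => eA.
  have bi y : y.1.1 = e -> boundary_inv A y = flag_side y.
    by rewrite /boundary_inv => ->; rewrite eA.
  by rewrite !bi // !flag_sideK eq_pairs white_pairingE.
have bi y : y.1.1 = e -> boundary_inv A y = flag_end y.
  by rewrite /boundary_inv => ->; rewrite (negPf eA).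
rewrite !bi // flag_side_end !flag_endK black_pairingE flag_side_end -/x.
set a := phi (medial_edge_of x); set b := phi (medial_edge_of (flag_side x)).
set c := phi _; set d := phi _.
by rewrite (eq_sym a d) (eq_sym c b); case: (d == a); case: (b == c).
Qed.

End Colourings.

Lemma petrial_flag_side (G : ribbonGraph) (A : {set edge G}) (y : flag G) :
  @flag_side (petrial A) y
  = if y.1.1 \in A then flag_end (flag_side y) else flag_side y.
Proof.
by case: y => [[e d] s]; rewrite /flag_side /flag_end /=; case: ifP;
  rewrite ?addbT ?addbF ?addbN.
Qed.

Lemma card_petrial_colourings (G : ribbonGraph) (k : nat) (A : {set edge G}) :
  #|[set phi : {ffun cedge (medial G) -> 'I_k} |
      [forall e, if e \in A then crossing_pairing phi e else white_pairing phi e]]|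
  = (k ^ @nfaces (petrial A) setT)%N.
Proof.
rewrite -card_boundary_colourings; apply: eq_card => phi; rewrite !inE.
(* [petrial A] has the same flags and corner arcs as [G], hence the same medial edges; only
   [flag_side] changes, becoming a diagonal on [A]. *)
rewrite [RHS](@forall_flag_edge G
  (fun x => phi (medial_edge_of x)
            == phi (medial_edge_of (@boundary_inv (petrial A) setT x)))).
apply: eq_forallb => e; cbv zeta; set x : flag G := ((e, false), false).
case: (boolP (e \in A)) => eA.
  have bi (y : flag G) : y.1.1 = e ->
      @boundary_inv (petrial A) setT y = flag_end (flag_side y).
    by rewrite /boundary_inv in_setT petrial_flag_side => ->; rewrite eA.
  rewrite !bi // flag_side_end !flag_sideK -!flag_side_end !flag_endK !flag_sideK.
  rewrite crossing_pairingE -/x.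
  set a := phi (medial_edge_of x); set b := phi (medial_edge_of (flag_side x)).
  set c := phi _; set d := phi _.
  by rewrite (eq_sym c a) (eq_sym d b); case: (a == c); case: (b == d).
have bi (y : flag G) : y.1.1 = e ->
    @boundary_inv (petrial A) setT y = flag_side y.
  by rewrite /boundary_inv in_setT petrial_flag_side => ->; rewrite (negPf eA).
by rewrite !bi // !flag_sideK eq_pairs white_pairingE.
Qed.

(** * State sums *)

Section StateSums.
Variables (F : fieldType) (G : ribbonGraph) (k : nat).
Let K : F := k%:R.

Lemma Rpermissible_state_sum (b : F) :
  \sum_(A : {set edge G}) b ^+ #|A| * K ^+ nfaces A
  = \sum_(phi in Rpermissible (medial G) k) (b + 1) ^+ tot phi * b ^+ wh phi.
Proof.
rewrite [RHS]big_mkcond /=.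
transitivity (\sum_(phi : {ffun cedge (medial G) -> 'I_k})
   \prod_v (b * (white_pairing phi v)%:R + (black_pairing phi v)%:R)).
  rewrite -sum_subset_count; apply: eq_bigr => A _.
  by rewrite card_pairing_colourings natrX.
apply: eq_bigr => phi _; rewrite Rpermissible_weight.
by case: (phi \in _); rewrite ?mulr0 ?mulr1.
Qed.

Lemma penrosePoly_state_sum :
  penrosePoly G K = \sum_(phi in admissible (medial G) k) (-1) ^+ cr phi.
Proof.
rewrite [RHS]big_mkcond /=.
transitivity (\sum_(phi : {ffun cedge (medial G) -> 'I_k})
   \prod_v (-1 * (crossing_pairing phi v)%:R + (white_pairing phi v)%:R) : F).
  rewrite -sum_subset_count; apply: eq_bigr => A _.
  by rewrite card_petrial_colourings natrX.
apply: eq_bigr => phi _; rewrite admissible_weight.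
by case: (phi \in _); rewrite ?mulr0 ?mulr1.
Qed.

Hypothesis K0 : K != 0.
Variable b : F.
Hypothesis b0 : b != 0.

(** The exponent of [b] collapses to [rank A + nullity A = |A|]. That of [K] collapses to [f(A)],
    since [c + r] is the number of vertices for both [G] and [A]. *)
Lemma ribbonPoly_term (A : {set edge G}) :
  K ^+ ncomp [set: edge G] * b ^ rank [set: edge G]
    * ((K / b) ^ (rank [set: edge G] - rank A) * (b * K) ^ nullity A
       * K ^ (- euler_genus A))
  = b ^+ #|A| * K ^+ nfaces A.
Proof.
rewrite !expfzMl exprz_inv !exprnP.
transitivity (b ^ (rank [set: edge G] - (rank [set: edge G] - rank A) + nullity A)
  * K ^ ((ncomp [set: edge G])%:Z + (rank [set: edge G] - rank A) + nullity A
         - euler_genus A)).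
  have ac (k0 k1 k2 k3 b0' b1 b2 : F) :
      k0 * b0' * (k1 * b1 * (b2 * k2) * k3) = b0' * b1 * b2 * (k0 * k1 * k2 * k3).
    by ring.
  rewrite (expfzDr _ (nullity A) b0) (expfzDr (rank setT) _ b0).
  rewrite (expfzDr _ (- euler_genus A) K0) (expfzDr _ (nullity A) K0).
  rewrite (expfzDr _%:Z _ K0).
  exact: ac.
by congr (b ^ _ * K ^ _); rewrite /euler_genus /nullity /rank; lia.
Qed.

Lemma ribbonPoly_state_sum :
  K ^+ ncomp [set: edge G] * b ^ rank [set: edge G]
    * ribbonPoly G ((K + b) / b) (b * K) (1 / K)
  = \sum_(phi in Rpermissible (medial G) k) (b + 1) ^+ tot phi * b ^+ wh phi.
Proof.
rewrite -Rpermissible_state_sum mulr_sumr; apply: eq_bigr => A _.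
rewrite -ribbonPoly_term; congr (_ * (_ ^ _ * _ * _)).
  by rewrite mulrDl divff // addrK.
by rewrite div1r exprz_inv.
Qed.

(** The Tutte term is the ribbon term without [K ^ (- euler_genus A)], a factor equal to 1 here. *)
Lemma tuttePoly_state_sum : plane G ->
  K ^+ ncomp [set: edge G] * b ^ rank [set: edge G]
    * tuttePoly G (K / b + 1) (K * b + 1)
  = \sum_(phi in Rpermissible (medial G) k) (b + 1) ^+ tot phi * b ^+ wh phi.
Proof.
move=> plG; rewrite -Rpermissible_state_sum mulr_sumr; apply: eq_bigr => A _.
by rewrite -ribbonPoly_term (plane_euler_genus A plG) oppr0 expr0z mulr1 !addrK (mulrC b).
Qed.

End StateSums.

Theorem mainTheorem2 (R : realType) (G : ribbonGraph) (k : nat) (hk : (0 < k)%N)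
    (b : R[i]) (hb : b != 0) :
  let K : R[i] := k%:R in
  [/\ K ^+ ncomp [set: edge G] * ribbonPoly G (K + 1) K (1 / K)
      = \sum_(phi in Rpermissible (medial G) k) 2 ^+ tot phi,
      penrosePoly G K
      = \sum_(phi in admissible (medial G) k) (-1) ^+ cr phi,
      K ^+ ncomp [set: edge G] * b ^ rank [set: edge G]
        * ribbonPoly G ((K + b) / b) (b * K) (1 / K)
      = \sum_(phi in Rpermissible (medial G) k) (b + 1) ^+ tot phi * b ^+ wh phi
    & plane G ->
      K ^+ ncomp [set: edge G] * b ^ rank [set: edge G]
        * tuttePoly G (K / b + 1) (K * b + 1)
      = \sum_(phi in Rpermissible (medial G) k) (b + 1) ^+ tot phi * b ^+ wh phi].
Proof.
move=> K; have K0 : K != 0 by rewrite pnatr_eq0 -lt0n.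
split; last exact: tuttePoly_state_sum.
- have := ribbonPoly_state_sum G K0 (oner_neq0 _).
  rewrite exp1rz mulr1 divr1 (mul1r K) => ->.
  by apply: eq_bigr => phi _; rewrite expr1n mulr1.
- exact: penrosePoly_state_sum.
- exact: ribbonPoly_state_sum.
Qed.
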